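(* Let $k$ be a field of characteristic zero, let $m\geq 3$ and $0\leq r\leq m-2$ be integers, and let $f=\det \mathcal{H}_m[r]\in R=k[x_1,\ldots,x_{2m-r-1}]$. Then the dual variety $V(f)^*$ of the hypersurface $V(f)\subset \mathbb{P}^{2m-r-2}$ satisfies $\dim V(f)^*\geq m-1$.
   Context: $\mathcal{H}_m[r]$ denotes the $m\times m$ matrix whose $(i,j)$ entry is the variable $x_{i+j-1}$ if $i+j\leq 2m-r$ and $0$ if $i+j>2m-r$. Its ground ring is $R=k[x_1,\ldots,x_{2m-r-1}]$. The polynomial $f$ is irreducible for $r\leq m-2$. The dual variety $V(f)^*$ is the closure in the (dual) projective space $\mathbb{P}^{2m-r-2}$ of the image of $V(f)$ under the polar map given by the partial derivatives of $f$; that is, its homogeneous coordinate ring is $k[t_1,\ldots,t_{2m-r-1}]/\mathcal{D}$, where $\mathcal{D}$ is the kernel of the $k$-algebra map $k[t_1,\ldots,t_{2m-r-1}]\to R/(f)$, $t_i\mapsto \partial f/\partial x_i \bmod f$. The dimension is the dimension as a projective variety. *)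

(* Defs.v *)
From HB Require Import structures.
From mathcomp Require Import all_boot all_order all_algebra.
From mathcomp Require Import mpoly.

Set Implicit Arguments.
Unset Strict Implicit.
Unset Printing Implicit Defensive.

Import GRing.Theory.
Local Open Scope ring_scope.

Definition nvars (m r : nat) : nat := (2 * m - r - 1)%N.

(* Rows, columns and variables are numbered from 0, so that the 1-based entry
   x_{i+j-1} becomes 'X_(i + j), and the 1-based condition i + j <= 2m - r
   becomes i + j < nvars m r. *)
Definition hankel (k : fieldType) (m r : nat) :
    'M[{mpoly k[nvars m r]}]_m :=
  \matrix_(i < m, j < m)
    if insub (i + j)%N is Some l then 'X_(l : 'I_(nvars m r)) else 0.

Definition hankel_det (k : fieldType) (m r : nat) : {mpoly k[nvars m r]} :=
  \det (hankel k m r).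

Section Projective.
Variables (k : fieldType) (n : nat).
Implicit Types (f g : {mpoly k[n]}) (I : {mpoly k[n]} -> Prop).
Implicit Types (p : pred {mpoly k[n]}).

Definition principal_ideal f : {mpoly k[n]} -> Prop :=
  fun g => exists h, g = h * f.

(* The kernel of k[t_1..t_n] -> k[x_1..x_n]/(f), t_i |-> df/dx_i mod f: the
   homogeneous ideal of the dual variety of V(f). *)
Definition dual_ideal f : {mpoly k[n]} -> Prop :=
  fun P => principal_ideal f (P \mPo [tuple f^`M(i) | i < n]).

Definition homogeneous_ideal p : Prop :=
  forall d, {in p, forall g, pihomog mdeg d g \in p}.

(* The points of the scheme Proj k[t_1..t_n], equivalently the irreducible
   closed subsets of P^(n-1): homogeneous primes that do not contain the
   irrelevant ideal (t_1, .., t_n). *)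
Definition proj_point p : Prop :=
  [/\ idealr_closed p, prime_idealr_closed p, homogeneous_ideal p
    & exists i : 'I_n, 'X_i \notin p].

(* A chain Z_0 > .. > Z_e of nonempty irreducible closed subsets of the closed
   subset V(I) of P^(n-1), given by their prime ideals. *)
Definition proj_chain I (e : nat) (c : nat -> pred {mpoly k[n]}) : Prop :=
  [/\ forall s, (s <= e)%N -> proj_point (c s),
      forall s, (s <= e)%N -> forall g, I g -> g \in c s
    & forall s, (s < e)%N -> {subset c s <= c s.+1}
                             /\ exists2 g, g \in c s.+1 & g \notin c s].

(* dim V(I) >= d, where dim V(I) is the supremum of the lengths of the chains
   of irreducible closed subsets of V(I), as a subspace of P^(n-1). *)
Definition proj_dim_ge I (d : nat) : Prop :=
  exists2 e, (d <= e)%N & exists c, proj_chain I e c.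

End Projective.

(* Main.v *)
(* Let q_l be the coefficient of T^l in (v_0 + v_1 T + .. + v_(m-1) T^(m-1))^2,
   for l < n = 2m - r - 1.  A Hankel matrix of corank 1 with kernel spanned by v
   has adjugate proportional to v v^T, so the polar map sends it to
   (q_0 : .. : q_(n-1)).  For generic v there is such a matrix whose (i, j)
   entry, with i and j numbered from 0, vanishes for i + j > m: up to scaling,
   its other entries are the first coefficients of 1 / (v_0 + v_1 T + ..), in
   reverse order.  Hence the ideal of
   the dual variety is contained in the kernel of t_l |-> q_l.  Setting to 0 the
   last s variables among v_0, .., v_(m-1), for s = 0, .., m - 1, gives a chain
   of homogeneous primes; it is strict because n >= m and the q_l with l < m
   determine v up to sign when v_0 is nonzero. *)

Require Import Defs.
From mathcomp Require Import all_boot all_order all_algebra.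
From mathcomp Require Import mpoly.
From mathcomp Require Import perm zify ring.

Set Implicit Arguments.
Unset Strict Implicit.
Unset Printing Implicit Defensive.

Import GRing.Theory.
Local Open Scope ring_scope.

(** * Substitution and partial derivatives of the Hankel determinant *)

Lemma comp_mpolyA (R : comNzRingType) (n p q : nat)
    (s : n.-tuple {mpoly R[p]}) (t : p.-tuple {mpoly R[q]}) (g : {mpoly R[n]}) :
  (g \mPo s) \mPo t = g \mPo [tuple tnth s i \mPo t | i < n].
Proof.
rewrite (comp_mpolyEX g s) raddf_sum [RHS]comp_mpolyEX.
apply: eq_bigr => u _ /=; rewrite comp_mpolyZ !comp_mpolyX rmorph_prod /=.
by congr (_ *: _); apply: eq_bigr => i _; rewrite rmorphXn tnth_mktuple.
Qed.

Lemma mderiv_prod (R : comNzRingType) (n : nat) (l : 'I_n) (I : eqType)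
    (s : seq I) (F : I -> {mpoly R[n]}) : uniq s ->
  (\prod_(i <- s) F i)^`M(l)
  = \sum_(i <- s) \prod_(j <- s) (if j == i then (F j)^`M(l) else F j).
Proof.
elim: s => [_|a s IH /= /andP[as_ us]].
  by rewrite !big_nil -mpolyC1 mderivC.
rewrite !big_cons mderivM IH // eqxx; congr (_ + _).
  congr (_ * _); rewrite !big_seq; apply: eq_bigr => i i_s.
  by case: eqP => // e; rewrite -e i_s in as_.
rewrite big_distrr /= !big_seq; apply: eq_bigr => i i_s.
by rewrite big_cons; case: eqP => // e; rewrite e i_s in as_.
Qed.

(** Jacobi's formula: by the Leibniz rule the derivative is a sum of determinants with one row
    differentiated, each expanded along that row. *)
Lemma mderiv_det (R : comNzRingType) (n p : nat) (l : 'I_n)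
    (A : 'M[{mpoly R[n]}]_p) :
  (\det A)^`M(l) = \sum_i \sum_j (A i j)^`M(l) * cofactor A i j.
Proof.
pose B i := \matrix_(a, b) (if a == i then (A a b)^`M(l) else A a b).
transitivity (\sum_i \det (B i)).
  rewrite /determinant [RHS]exchange_big raddf_sum; apply: eq_bigr => s _ /=.
  have -> (b : bool) g : ((-1) ^+ b * g)^`M(l) = (-1) ^+ b * g^`M(l).
    by rewrite !mulr_sign; case: b; rewrite ?mderivN.
  rewrite mderiv_prod ?index_enum_uniq // big_distrr /=; apply: eq_bigr => i _.
  by congr (_ * _); apply: eq_bigr => j _; rewrite mxE.
apply: eq_bigr => i _; rewrite (expand_det_row _ i); apply: eq_bigr => j _.
rewrite mxE eqxx; congr (_ * _); rewrite /cofactor; congr (_ * \det _).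
by apply/matrixP=> a b; rewrite !mxE eq_sym (negPf (neq_lift _ _)).
Qed.

Lemma hankelE (k : fieldType) (m r : nat) (i j : 'I_m)
    (ltij : (i + j < nvars m r)%N) :
  hankel k m r i j = 'X_(Ordinal ltij).
Proof. by rewrite mxE insubT. Qed.

Lemma hankel0 (k : fieldType) (m r : nat) (i j : 'I_m) :
  (nvars m r <= i + j)%N -> hankel k m r i j = 0.
Proof. by move=> h; rewrite mxE insubF // ltnNge h. Qed.

(** The variable of index [l] fills exactly the antidiagonal i + j = l, so Jacobi's formula keeps
    only the cofactors there. *)
Lemma mderiv_hankel_det (k : fieldType) (m r : nat) (l : 'I_(nvars m r)) :
  (hankel_det k m r)^`M(l)
  = \sum_i \sum_j cofactor (hankel k m r) i j *+ (i + j == l)%N.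
Proof.
rewrite mderiv_det; apply: eq_bigr => i _; apply: eq_bigr => j _.
rewrite -mulr_natl; congr (_ * _).
case: (ltnP (i + j) (nvars m r)) => h.
  rewrite hankelE mderivX mnmE -val_eqE /=.
  case: eqP => [e|_]; last by rewrite scale0r.
  rewrite scale1r (_ : (U_(_) - _)%MM = 0%MM) ?mpolyX0 //.
  by apply/mnmP=> a; rewrite !mnmE -!val_eqE /= e subnn.
rewrite hankel0 // mderiv0; case: eqP => // e.
by have := ltn_ord l; rewrite -e ltnNge h.
Qed.

(** * Hankel matrices vanishing past an antidiagonal, and truncated inverses *)

Section AntiTriangular.
Variables (A : idomainType) (M : nat) (x : nat -> A).
Let m := M.+1.
Let H : 'M[A]_m := \matrix_(i < m, j < m) x (i + j)%N.
Hypothesis x_gt : forall l, (m < l)%N -> x l = 0.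
Hypothesis x_m : x m != 0.

(** Forward substitution: in row m - j the last entry that can be nonzero is x_m, in column j, so
    the vanishing of the earlier coordinates forces u_j = 0. *)
Lemma antitriangular_ker (u : 'I_m -> A) : u ord0 = 0 ->
  (forall i : 'I_m, i != ord0 -> \sum_(j < m) x (i + j)%N * u j = 0) ->
  forall j, u j = 0.
Proof.
move=> u0 Hu j; have [N] := ubnP (j : nat); elim: N j => // N IH j leN.
case: (posnP j) => [j0|j_gt0].
  by rewrite (_ : j = ord0) //; apply: val_inj.
have lti : (m - j < m)%N by have := ltn_ord j; lia.
have := Hu (Ordinal lti); rewrite (bigD1 j) //= big1 => [|j' nej].
  rewrite addr0 subnK; last by have := ltn_ord j; lia.
  move=> /(_ _)/eqP; rewrite mulf_eq0 (negPf x_m) => h; apply/eqP/h.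
  by rewrite -val_eqE /=; have := ltn_ord j; lia.
have [ltj|] := ltnP j' j; first by rewrite IH ?mulr0 //; lia.
rewrite leq_eqVlt val_eqE eq_sym (negPf nej) /= => ltj.
by rewrite x_gt ?mul0r //; have := ltn_ord j; lia.
Qed.

Lemma antitriangular_cofactor_neq0 : cofactor H ord0 ord0 != 0.
Proof.
rewrite /cofactor addn0 expr0 mul1r -det_tr; apply/negP => /det0P[u u0 uB].
case/eqP: u0; apply/rowP=> a; rewrite [RHS]mxE.
(* A kernel vector of the minor, extended by 0 at index 0, meets the hypotheses of
   [antitriangular_ker]. *)
pose u' j := if unlift ord0 j is Some j' then u 0 j' else 0 : A.
suff /(_ (lift ord0 a)) : forall j, u' j = 0 by rewrite /u' liftK.
apply: antitriangular_ker => [|i]; first by rewrite /u' unlift_none.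
case: (unliftP ord0 i) => [i' ->|->]; last by rewrite eqxx.
move=> _; have /rowP/(_ i') := uB; rewrite !mxE => e.
rewrite -[RHS]e big_ord_recl {1}/u' unlift_none mulr0 add0r.
by apply: eq_bigr => j _; rewrite /u' liftK !mxE mulrC.
Qed.

Variable v : 'I_m -> A.
Hypothesis v0 : v ord0 != 0.
Hypothesis Hv : forall i : 'I_m, \sum_(j < m) x (i + j)%N * v j = 0.

Lemma antitriangular_det : \det H = 0.
Proof.
rewrite -det_tr; apply/eqP/det0P; exists (\row_j v j).
  by apply: contraNneq v0 => /rowP/(_ ord0); rewrite !mxE => ->.
apply/rowP=> i; rewrite !mxE -[RHS](Hv i).
by apply: eq_bigr => j _; rewrite !mxE mulrC.
Qed.

(** Division-free form of the proportionality between adj H and v v^T. As det H = 0, each row of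
    cofactors lies in the kernel of H, and so does v. Hence v_0 C_ab - v_b C_a0, which is 0 at b =
    0, vanishes for all b; symmetry of H handles the other index. *)
Lemma antitriangular_cofactor (i j : 'I_m) :
  v ord0 ^+ 2 * cofactor H i j = cofactor H ord0 ord0 * (v i * v j).
Proof.
have half a b : v ord0 * cofactor H a b = v b * cofactor H a ord0.
  apply/eqP; rewrite -subr_eq0; apply/eqP; move: b.
  apply: antitriangular_ker => [|b _]; first by rewrite subrr.
  have adj0 : \sum_(c < m) x (b + c)%N * cofactor H a c = 0.
    have /matrixP/(_ b a) := mul_mx_adj H.
    rewrite antitriangular_det !mxE mul0rn => e; rewrite -[RHS]e.
    by apply: eq_bigr => c _; rewrite !mxE.
  transitivity (v ord0 * (\sum_(c < m) x (b + c)%N * cofactor H a c)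
                - cofactor H a ord0 * (\sum_(c < m) x (b + c)%N * v c)).
    by rewrite !big_distrr -sumrB; apply: eq_bigr => c _ /=; ring.
  by rewrite adj0 Hv !mulr0 subrr.
have symH : H^T = H by apply/matrixP=> a b; rewrite !mxE addnC.
by rewrite expr2 -mulrA half mulrCA -cofactor_tr symH half; ring.
Qed.

End AntiTriangular.

(** [Z] is the truncated geometric series of 1 / U: since 1 - U has no constant term, (1 - U)^(N+1)
    contributes nothing up to degree N. *)
Lemma poly_inv_trunc (A : comNzRingType) (U : {poly A}) (N : nat) :
  U`_0 = 1 -> exists Z : {poly A},
    Z`_0 = 1 /\ forall j, (0 < j <= N)%N -> (U * Z)`_j = 0.
Proof.
move=> U0; pose Z := \sum_(i < N.+1) (1 - U) ^+ i.
have UZ : U * Z = 1 - (1 - U) ^+ N.+1.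
  by rewrite -[RHS]opprB subrX1 -mulNr; congr (_ * _); ring.
have UZ0 j : (j <= N)%N -> (U * Z)`_j = (j == 0%N)%:R.
  move=> leN; rewrite UZ coefB coef1.
  suff [W ->] : exists W, 1 - U = W * 'X.
    by rewrite exprMn coefMXn ltnS leN subr0.
  have /factor_theorem[W ->] : root (1 - U) 0.
    by rewrite /root horner_coef0 coefB coef1 U0 subrr.
  by exists W; rewrite subr0.
exists Z; split; last by move=> [//|j] /= leN; rewrite UZ0.
by have := UZ0 0%N isT; rewrite coef0M U0 mul1r.
Qed.

(** * Homogeneity under products, derivatives and substitution *)

Lemma dhomog_bigprod (R : comNzRingType) (n : nat) (I : finType)
    (F : I -> {mpoly R[n]}) (d : I -> nat) :
  (forall i, F i \is (d i).-homog) ->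
  \prod_i F i \is (\sum_i d i)%N.-homog.
Proof.
move=> hF; elim/big_rec2: _ => [|i e y _ IH]; first exact: dhomog1.
exact: dhomogM.
Qed.

Lemma dhomog_det (R : comNzRingType) (n p : nat) (A : 'M[{mpoly R[n]}]_p) :
  (forall i j, A i j \is 1.-homog) -> \det A \is p.-homog.
Proof.
move=> hA; apply: rpred_sum => s _.
suff h : \prod_i A i (s i) \is p.-homog.
  by rewrite mulr_sign; case: ifP; rewrite ?dhomogN.
have := @dhomog_bigprod _ _ _ (fun i => A i (s i)) (fun=> 1%N).
by rewrite sum1_card card_ord; apply.
Qed.

Lemma dhomog_mderiv (R : comNzRingType) (n d : nat) (l : 'I_n)
    (f : {mpoly R[n]}) : f \is d.+1.-homog -> f^`M(l) \is d.-homog.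
Proof.
move=> /dhomogP hf; rewrite (mpolyE f) raddf_sum /= big_seq.
apply: rpred_sum => u /hf du; rewrite mderivZ mderivX; apply/dhomogZ.
(* When [u l] is 0 the truncated difference of monomials does not lower the degree, but its
   coefficient is 0. *)
case: (posnP (u l)) => [->|ul]; first by rewrite scale0r dhomog0.
apply/dhomogZ; rewrite dhomogX -eqSS -du -[X in _ == mdeg X](@submK _ U_(l)).
  by rewrite mdegD mdeg1 addn1.
by apply/mnm_lepP => i; rewrite mnmE; case: eqP => // <-.
Qed.

(** Substituting forms of degree e multiplies degrees by e; as e > 0, distinct degrees stay
    distinct. *)
Lemma pihomog_comp (R : comNzRingType) (n p e d : nat)
    (q : n.-tuple {mpoly R[p]}) (g : {mpoly R[n]}) : (0 < e)%N ->
  (forall i, tnth q i \is e.-homog) ->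
  pihomog mdeg (e * d) (g \mPo q) = pihomog mdeg d g \mPo q.
Proof.
move=> e_gt0 hq.
have hX (u : 'X_{1..n}) : 'X_[u] \mPo q \is (e * mdeg u).-homog.
  rewrite comp_mpolyX mdegE big_distrr /=.
  by apply: dhomog_bigprod => i; apply/dhomogMn/hq.
elim/mpolyind: g => [|c u g _ _ IH]; first by rewrite !linear0.
rewrite !linearP /= IH; congr (c *: _ + _).
have [<-|ne] := eqVneq (mdeg u) d.
  by rewrite pihomog_dE ?hX // pihomog_dE // dhomogX.
rewrite (pihomog_ne0 _ (hX u)) ?eqn_pmul2l //.
by rewrite (pihomog_ne0 ne) ?linear0 // dhomogX.
Qed.

Lemma principal_ideal_pihomog (k : fieldType) (n d e : nat)
    (f g : {mpoly k[n]}) : f \is d.-homog ->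
  principal_ideal f g -> principal_ideal f (pihomog mdeg e g).
Proof.
move=> hf [h ->]; elim/mpolyind: h => [|c u h _ _ [h' IH]].
  by exists 0; rewrite !mul0r linear0.
have hu : 'X_[u] * f \is (mdeg u + d)%N.-homog.
  by apply: dhomogM; rewrite ?dhomogX.
rewrite mulrDl -scalerAl linearP /= IH.
have [<-|ne] := eqVneq (mdeg u + d)%N e.
  by exists (c *: 'X_[u] + h'); rewrite pihomog_dE // mulrDl -scalerAl.
by exists h'; rewrite (pihomog_ne0 ne) // scaler0 add0r.
Qed.

(** Degree d + 2 makes the partial derivatives forms of positive degree d + 1, as [pihomog_comp]
    requires. *)
Lemma dual_ideal_pihomog (k : fieldType) (n d e : nat) (f g : {mpoly k[n]}) :
  f \is d.+2.-homog -> dual_ideal f g -> dual_ideal f (pihomog mdeg e g).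
Proof.
move=> hf; rewrite /dual_ideal -(@pihomog_comp _ _ _ d.+1) //.
  exact: principal_ideal_pihomog hf.
by move=> i; rewrite tnth_mktuple; apply: dhomog_mderiv.
Qed.

Lemma comp_mpoly_scale (R : comNzRingType) (n p d : nat)
    (q q' : n.-tuple {mpoly R[p]}) (c : {mpoly R[p]}) (g : {mpoly R[n]}) :
  g \is d.-homog -> (forall i, tnth q' i = c * tnth q i) ->
  g \mPo q' = c ^+ d * (g \mPo q).
Proof.
move=> /dhomogP hg hq; rewrite !comp_mpolyE big_distrr /= !big_seq.
apply: eq_bigr => u /hg <-; rewrite -scalerAr /= mdegE expr_sum -big_split.
by congr (_ *: _); apply: eq_bigr => i _ /=; rewrite hq exprMn.
Qed.

Lemma raddf_pihomog_eq0 (R : comNzRingType) (S : zmodType) (n : nat)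
    (F : {additive {mpoly R[n]} -> S}) (g : {mpoly R[n]}) :
  (forall d, F (pihomog mdeg d g) = 0) -> F g = 0.
Proof.
by move=> h; rewrite (pihomog_partitionE (leqnn (msize g))) raddf_sum big1.
Qed.

(** * The chain of primes given by squares of truncated generic polynomials *)

Section TruncatedSquare.
Variables (k : fieldType) (M : nat).
Let A := {mpoly k[M.+1]}.

Definition genpoly (s : nat) : {poly A} :=
  \poly_(i < M.+1 - s) 'X_(inord i).

Definition sqr_coefs (n s : nat) : n.-tuple A :=
  [tuple (genpoly s ^+ 2)`_l | l < n].

Definition kill_last (s : nat) : M.+1.-tuple A :=
  [tuple if (i < M.+1 - s)%N then 'X_i else 0 | i < M.+1].

Lemma coef_genpoly_kill (s t i : nat) : (s <= t)%N ->
  (genpoly s)`_i \mPo kill_last t = (genpoly t)`_i.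
Proof.
move=> st; rewrite !coef_poly.
have [lt|ge] := ltnP i (M.+1 - s); last first.
  by rewrite comp_mpoly0 ifF //; lia.
by rewrite comp_mpolyXU -tnth_nth tnth_mktuple inordK //; lia.
Qed.

(** The map for t factors through the map for s, which is why the kernels increase with s. *)
Lemma comp_sqr_coefs_kill (n s t : nat) (g : {mpoly k[n]}) : (s <= t)%N ->
  (g \mPo sqr_coefs n s) \mPo kill_last t = g \mPo sqr_coefs n t.
Proof.
move=> st; rewrite comp_mpolyA; congr (g \mPo _); apply: eq_mktuple => l.
rewrite tnth_mktuple !expr2 !coefM rmorph_sum; apply: eq_bigr => i _ /=.
by rewrite rmorphM /= !coef_genpoly_kill.
Qed.

Lemma dhomog_sqr_coefs (n s : nat) (l : 'I_n) :
  tnth (sqr_coefs n s) l \is 2.-homog.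
Proof.
rewrite tnth_mktuple expr2 coefM; apply: rpred_sum => i _.
have h j : (genpoly s)`_j \is 1.-homog.
  by rewrite coef_poly; case: ifP; rewrite ?dhomog0 // dhomogX /= mdeg1.
exact: (dhomogM (h _) (h _)).
Qed.

Definition sqr_ideal (n s : nat) : pred {mpoly k[n]} :=
  fun g => g \mPo sqr_coefs n s == 0.

(** A kernel of a map into a domain is prime; it is homogeneous because all q_l have degree 2, and
    it omits t_0, whose image is v_0^2. *)
Lemma sqr_ideal_proj_point (n s : nat) : (0 < n)%N -> (s <= M)%N ->
  proj_point (@sqr_ideal n s).
Proof.
move=> n_gt0 sM; split.
- split; rewrite ?unfold_in /sqr_ideal ?comp_mpoly0 ?comp_mpoly1 ?oner_eq0 //.
  move=> a u v; rewrite !unfold_in rmorphD rmorphM /= => /eqP-> /eqP->.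
  by rewrite mulr0 addr0.
- by move=> u v; rewrite !unfold_in /sqr_ideal rmorphM mulf_eq0.
- move=> d g; rewrite !unfold_in /sqr_ideal => /eqP g0.
  rewrite -(@pihomog_comp _ _ _ 2) ?g0 ?linear0 //.
  exact: dhomog_sqr_coefs.
- exists (Ordinal n_gt0); rewrite unfold_in /sqr_ideal comp_mpolyXU -tnth_nth.
  rewrite tnth_mktuple expr2 coef0M coef_poly subn_gt0 ltnS sM.
  by rewrite mulf_neq0 // -msize_poly_eq0 mmeasureX.
Qed.

Lemma sqr_ideal_sub (n s t : nat) : (s <= t)%N ->
  {subset @sqr_ideal n s <= @sqr_ideal n t}.
Proof.
move=> st g; rewrite !unfold_in /sqr_ideal -(comp_sqr_coefs_kill _ st).
by move=> /eqP->; rewrite comp_mpoly0.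
Qed.

(* The square root of a power series in t_0, .., t_(n-1) has its j-th
   coefficient in k[t, 1 / (2 v_0)], by the recursion
   2 v_0 v_j = t_j - sum_(0 < i < j) v_i v_(j-i); the power of v_0 clears
   denominators. *)
Lemma sqr_coefs_root (n j : nat) : [pchar k] =i pred0 ->
  (M < n)%N -> (0 < j <= M)%N ->
  exists g : {mpoly k[n]},
    g \mPo sqr_coefs n 0 = 'X_ord0 ^+ (2 * j - 1) * 'X_(inord j).
Proof.
move=> char0 Mn.
have two0 : 2%:R != 0 :> k by have := char0 2%N; rewrite !inE /= => ->.
pose w i := (genpoly 0)`_i.
have wE i : (i <= M)%N -> w i = 'X_(inord i).
  by rewrite /w coef_poly subn0 ltnS => ->.
have w0 : w 0%N = 'X_ord0.
  by rewrite wE //; congr 'X_ _; apply: val_inj; rewrite /= inordK.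
have [N] := ubnP j; elim: N j => // N IH [//|j] leN /= jM.
have /fin_all_exists[G hG] : forall i : 'I_j, exists g : {mpoly k[n]},
    g \mPo sqr_coefs n 0 = w 0%N ^+ (2 * i.+1 - 1) * w i.+1.
  move=> i; have lti := ltn_ord i.
  by have [||g hg] := IH i.+1; [lia..|exists g; rewrite hg w0 wE //; lia].
have n0 : (0 < n)%N by lia.
have jn : (j.+1 < n)%N by lia.
(* The index treated is j + 1. The factor t_0^j becomes v_0^(2j), the power of v_0 carried by each
   product [G i * G (rev_ord i)]; only 2 v_0^(2j+1) v_(j+1) survives. *)
exists (2%:R^-1 *: ('X_(Ordinal n0) ^+ j * 'X_(Ordinal jn)
                    - \sum_(i < j) G i * G (rev_ord i))).
rewrite comp_mpolyZ rmorphB rmorphM rmorphXn rmorph_sum /=.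
rewrite !comp_mpolyXU -!tnth_nth !tnth_mktuple /= expr2 coef0M.
rewrite coefM big_ord_recl big_ord_recr /= subnn subn0.
under [X in _ * _ - X]eq_bigr => i _ do rewrite rmorphM /= !hG /=.
rewrite -w0 -wE // -!/(w _).
have -> : \sum_(i < j) w 0%N ^+ (2 * i.+1 - 1) * w i.+1
            * (w 0%N ^+ (2 * (j - i.+1).+1 - 1) * w (j - i.+1).+1)
   = (w 0%N * w 0%N) ^+ j *
     \sum_(i < j) w (bump 0 i) * w (j.+1 - bump 0 i)%N.
  rewrite big_distrr /=; apply: eq_bigr => i _; have lti := ltn_ord i.
  rewrite /bump /= add1n -subSn // -expr2 -exprM.
  have -> : (2 * j = (2 * i.+1 - 1) + (2 * (j.+1 - i.+1) - 1))%N by lia.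
  by rewrite exprD; ring.
set S := \sum_(i < j) _.
have -> : (2 * j.+1 - 1 = j + j + 1)%N by lia.
have -> : (w 0%N * w 0%N) ^+ j * (w 0%N * w j.+1 + (S + w j.+1 * w 0%N))
  - (w 0%N * w 0%N) ^+ j * S = 2%:R *: (w 0%N ^+ (j + j + 1) * w j.+1).
  by rewrite scaler_nat !exprD exprMn; ring.
by rewrite scalerA mulVf // scale1r.
Qed.

(** The witness maps to a power of v_0 times v_(M-s): this last variable survives in step s and is
    killed in step s + 1. *)
Lemma sqr_ideal_proper (n s : nat) : [pchar k] =i pred0 -> (M < n)%N ->
  (s < M)%N -> exists2 g, g \in @sqr_ideal n s.+1 & g \notin @sqr_ideal n s.
Proof.
move=> char0 Mn sM.
have [|g hg] := @sqr_coefs_root n (M - s) char0 Mn; first lia.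
have nzX (i : 'I_M.+1) : 'X_i != 0 :> A.
  by rewrite -msize_poly_eq0 mmeasureX.
have kX t (i : 'I_M.+1) : 'X_i \mPo kill_last t
    = if (i < M.+1 - t)%N then 'X_i else 0 :> A.
  by rewrite comp_mpolyXU -tnth_nth tnth_mktuple.
exists g; rewrite unfold_in /sqr_ideal -(@comp_sqr_coefs_kill _ 0) // hg;
  rewrite rmorphM rmorphXn /= !kX /= inordK; try lia.
  by rewrite [X in _ * X]ifF ?mulr0 ?eqxx //; lia.
by rewrite !ifT ?mulf_neq0 ?expf_neq0 //; lia.
Qed.

End TruncatedSquare.

(** * The dual ideal lies in the smallest prime of the chain *)

Lemma sum_conv (A : comNzRingType) (N l : nat) (W : {poly A}) :
  (size W <= N)%N ->
  \sum_(i < N) \sum_(j < N) (W`_i * W`_j) *+ (i + j == l)%N = (W ^+ 2)`_l.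
Proof.
move=> sW; have eW : W = \sum_(i < N) W`_i *: 'X^i.
  by rewrite -poly_def; apply/polyP=> i; rewrite coef_poly; case: ltnP => // h;
    rewrite nth_default // (leq_trans sW).
rewrite {3}eW expr2 big_distrlr /= coef_sum; apply: eq_bigr => i _.
rewrite coef_sum; apply: eq_bigr => j _.
by rewrite -scalerAl -scalerAr -exprD !coefZ coefXn eq_sym mulr_natr mulrnAr.
Qed.

Lemma dhomog_hankel_det (k : fieldType) (m r : nat) :
  hankel_det k m r \is m.-homog.
Proof.
apply: dhomog_det => i j; case: (ltnP (i + j) (nvars m r)) => h.
  by rewrite hankelE dhomogX /= mdeg1.
by rewrite hankel0 // dhomog0.
Qed.

(** Evaluation at [ev], a generic singular Hankel matrix, kills f and makes its partial derivatives
    proportional to the q_l. A form whose composite with these derivatives is a multiple of f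
    therefore vanishes at q. *)
Lemma dual_ideal_sqr_ideal (k : fieldType) (M r : nat)
    (g : {mpoly k[nvars M.+2 r]}) :
  (r <= M)%N -> dual_ideal (hankel_det k M.+2 r) g ->
  g \in @sqr_ideal k M.+1 (nvars M.+2 r) 0.
Proof.
move=> rM Dg; set m := M.+2; set n := nvars m r.
have mn : (m < n)%N by rewrite /n /nvars /m; lia.
rewrite unfold_in /sqr_ideal; apply/eqP.
apply: (raddf_pihomog_eq0 (F := @comp_mpoly _ _ _ (sqr_coefs k M.+1 n 0))) => d.
have {Dg} := dual_ideal_pihomog d (dhomog_hankel_det k m r) Dg.
have := pihomogP mdeg d g; move: (pihomog _ _ _) => {}g hg [h gE].
pose W := genpoly k M.+1 0; pose v0 : {mpoly k[m]} := 'X_ord0.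
(* With u(T) = v(v_0 T) / v_0, the constant term of u is 1, and the entries
   x_(m-j) = z_j v_0^(m-j) with z = 1 / u are polynomials in v. *)
pose U := \poly_(i < m.+1) (if i is i'.+1 then W`_i * v0 ^+ i' else 1).
have U0 : U`_0 = 1 by rewrite coef_poly.
have [Z [Z0 UZ]] := poly_inv_trunc m U0.
have W0 : W`_0 = v0.
  by rewrite coef_poly; congr 'X_ _; apply: val_inj; rewrite /= inordK.
have v0_neq0 : v0 != 0 by rewrite -msize_poly_eq0 mmeasureX.
have Wge i : (m <= i)%N -> W`_i = 0 by rewrite coef_poly subn0 ltnNge => ->.
pose x l := if (l <= m)%N then Z`_(m - l) * v0 ^+ l else 0.
have x_gt l : (m < l)%N -> x l = 0 by rewrite /x ltnNge => /negPf->.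
have x_m : x m != 0 by rewrite /x leqnn subnn Z0 mul1r expf_neq0.
have Wx (i : 'I_m) : \sum_(j < m) x (i + j)%N * W`_j = 0.
  have lti := ltn_ord i; pose J := (m - i)%N.
  have ltJ : (J < m.+1)%N by rewrite /J; lia.
  (* Column index m, where [W] vanishes, is added because J reaches m when i = 0. *)
  transitivity (\sum_(j < m.+1) x (i + j)%N * W`_j).
    by rewrite [RHS]big_ord_recr /= Wge // mulr0 addr0.
  transitivity (v0 ^+ i.+1 * (U * Z)`_J); last by rewrite UZ ?mulr0 // /J; lia.
  rewrite (bigID (fun j : 'I__ => (j < J.+1)%N)) /= addrC.
  rewrite big1 => [|j]; last first.
    by rewrite -leqNgt /J => h'; rewrite x_gt ?mul0r //; lia.
  rewrite add0r coefM big_distrr /=.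
  rewrite -(big_ord_widen _ (fun j => x (i + j)%N * W`_j)) //.
  apply: eq_bigr => j _; have := ltn_ord j; rewrite ltnS => leJ.
  have lem : (i + j <= m)%N by rewrite -leq_subRL // ltnW.
  rewrite /x lem [U`_j]coef_poly ifT; last exact: leq_ltn_trans ltJ.
  have -> : (m - (i + j) = J - j)%N by rewrite /J; lia.
  case: (j : nat) => [|j']; first by rewrite W0 addn0 exprSr; ring.
  by rewrite addnS exprS exprD exprS; ring.
pose ev := [tuple x l | l < n].
pose H := \matrix_(i < m, j < m) x (i + j)%N.
(* The zero entries of [hankel] have i + j >= n > m, where [x] vanishes as well. *)
have evH : map_mx (comp_mpoly ev) (hankel k m r) = H.
  apply/matrixP=> i j; rewrite [LHS]mxE [RHS]mxE.
  case: (ltnP (i + j) n) => h'.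
    by rewrite hankelE comp_mpolyXU -tnth_nth tnth_mktuple.
  by rewrite hankel0 // comp_mpoly0 x_gt //; lia.
have W0' : W`_(@ord0 M.+1) != 0 by rewrite W0.
have ev_f : hankel_det k m r \mPo ev = 0.
  by rewrite /hankel_det -det_map_mx evH; apply: (antitriangular_det W0' Wx).
(* The antidiagonal sums of v v^T are the coefficients q_l of the square. *)
have ev_df l : v0 ^+ 2 * ((hankel_det k m r)^`M(l) \mPo ev)
    = cofactor H ord0 ord0 * tnth (sqr_coefs k M.+1 n 0) l.
  rewrite mderiv_hankel_det rmorph_sum tnth_mktuple -(@sum_conv _ m).
    rewrite !big_distrr /=; apply: eq_bigr => i _.
    rewrite rmorph_sum !big_distrr /=; apply: eq_bigr => j _.
    rewrite rmorphMn -cofactor_map_mx evH !mulrnAr -W0.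
    by rewrite (antitriangular_cofactor x_gt x_m W0' Wx).
  by rewrite (leq_trans (size_poly _ _)) // subn0.
(* As [g] is now a form of degree d, the factor v_0^(2d) is absorbed as v_0^2 on each derivative,
   giving the cofactor times q_l; the nonzero cofactor then cancels. *)
have : v0 ^+ 2 ^+ d
    * ((g \mPo [tuple (hankel_det k m r)^`M(i) | i < n]) \mPo ev) = 0.
  by rewrite gE rmorphM /= ev_f !mulr0.
rewrite comp_mpolyA.
pose q := [tuple v0 ^+ 2 * ((hankel_det k m r)^`M(i) \mPo ev) | i < n].
rewrite -(comp_mpoly_scale (q' := q) hg); last first.
  by move=> i; rewrite !tnth_mktuple.
rewrite (comp_mpoly_scale (q := sqr_coefs k M.+1 n 0)
          (c := cofactor H ord0 ord0) hg); last first.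
  by move=> i; rewrite tnth_mktuple ev_df.
move/eqP; rewrite mulf_eq0 => /orP[|/eqP//].
by rewrite expf_eq0 (negPf (antitriangular_cofactor_neq0 x_gt x_m)) andbF.
Qed.

Theorem proposition3p2 (k : fieldType) (m r : nat)
    (char0 : [pchar k] =i pred0) (m_ge3 : (3 <= m)%N) (r_le : (r <= m - 2)%N) :
  proj_dim_ge (dual_ideal (hankel_det k m r)) (m - 1).
Proof.
case: m m_ge3 r_le => [|[|M]] // _ r_le.
have rM : (r <= M)%N by lia.
have Mn : (M.+1 < nvars M.+2 r)%N by rewrite /nvars; lia.
exists (M.+2 - 1)%N => //; exists (@sqr_ideal k M.+1 (nvars M.+2 r)).
split=> [s sM|s _ g Dg|s sM].
- by apply: sqr_ideal_proj_point; lia.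
- exact: sqr_ideal_sub (leq0n s) g (dual_ideal_sqr_ideal rM Dg).
- split; first exact: sqr_ideal_sub.
  by apply: sqr_ideal_proper => //; lia.
Qed.
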